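(* If $T$ is a tree with radius $2$ and diameter $4$, then $\pi^{c}(T)=4$.
   Context: A configuration of cops on $T$ is a function $C:V(T)\to\mathbb{Z}_{\ge 0}$ of size $\sum_v C(v)$. A pebbling step from a vertex $u$ with at least two cops to an adjacent vertex $v$ removes two cops from $u$ and adds one cop to $v$. In the cops and robbers pebbling game, cops are placed according to $C$, then a robber chooses a starting vertex; thereafter, in each turn the cops make pebbling steps, after which the robber either moves to an adjacent vertex or stays put. The robber is captured when he occupies a vertex holding at least one cop. The cop pebbling number $\pi^{c}(T)$ is the minimum $m$ such that some configuration of size $m$ allows the cops to capture the robber regardless of how he starts and moves. *)

(* Defs.v *)
From mathcomp Require Import all_boot.
From mathcomp Require Import boolp.
From Stdlib Require Import Relation_Operators.

Set Implicit Arguments.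
Unset Strict Implicit.
Unset Printing Implicit Defensive.

Section Graph.
Variables (T : finType) (e : rel T).

Definition simple_graph := symmetric e /\ irreflexive e.

(* An edge traversed back and forth is a [ucycle] of size 2, so a graph cycle
   is a [ucycle] of size at least 3. *)
Definition acyclic_graph := forall p : seq T, ucycle e p -> size p <= 2.

Definition is_tree :=
  [/\ simple_graph, 0 < #|T|, forall x y, connect e x y & acyclic_graph].

Definition has_walk (x y : T) (n : nat) : bool :=
  [exists p : n.-tuple T, path e x p && (last x p == y)].

(* The least length of a walk from x to y. Lengths below #|T| are enough for
   connected vertices; the value is #|T| when no walk exists. *)
Definition dist (x y : T) : nat := find (has_walk x y) (iota 0 #|T|).

Definition ecc (x : T) : nat := \max_(y : T) dist x y.

Definition diameter : nat := \max_(x : T) ecc x.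

(* No eccentricity exceeds the diameter, so this default does not affect the
   minimum over a nonempty graph. *)
Definition radius : nat := \big[minn/diameter]_(x : T) ecc x.

End Graph.

Section CopPebbling.
Variables (T : finType) (e : rel T).

Definition config := {ffun T -> nat}.

Definition config_size (C : config) : nat := \sum_(v : T) C v.

Definition pebbling_move (C : config) (u v : T) : config :=
  [ffun x => if x == u then C x - 2 else if x == v then C x + 1 else C x].

Definition pebbling_step (C C' : config) : Prop :=
  exists u v : T, [/\ e u v, 2 <= C u & C' = pebbling_move C u v].

(* In one turn the cops make any finite number of successive pebbling steps,
   possibly none. *)
Definition cops_turn : config -> config -> Prop :=
  clos_refl_trans config pebbling_step.

Definition captured (C : config) (r : T) : Prop := 0 < C r.

Definition robber_move (r r' : T) : Prop := r' = r \/ e r r'.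

(* [cops_win C r]: with the cops to play, cops at C and the robber at r, the
   cops can force a capture in finitely many turns. A capture in the middle of
   a turn is covered by [win_turn], as the cops may end the turn there. *)
Inductive cops_win (C : config) (r : T) : Prop :=
| win_captured : captured C r -> cops_win C r
| win_turn C' : cops_turn C C' -> captured C' r -> cops_win C r
| win_later C' : cops_turn C C' ->
    (forall r', robber_move r r' -> cops_win C' r') -> cops_win C r.

Definition winning_config (C : config) : Prop := forall r : T, cops_win C r.

Definition winning_size (m : nat) : Prop :=
  exists C : config, config_size C = m /\ winning_config C.

Lemma winning_size_exists : exists m, `[< winning_size m >].
Proof.
exists (config_size [ffun=> 1]); apply/asboolP; exists [ffun=> 1].
by split=> // r; apply: win_captured; rewrite /captured ffunE.
Qed.

Definition cop_pebbling_number : nat := ex_minn winning_size_exists.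

End CopPebbling.

(* Main.v *)
(* A robber who never moves is caught only at a vertex that the initial
   configuration can reach by pebbling steps, so a winning configuration reaches
   every vertex.  Four cops on a centre reach everything within distance 2.  At
   most three cops reach only occupied vertices, neighbours of a vertex with two
   cops, and neighbours of a single cop standing next to such a vertex; this
   cannot cover a geodesic a = x0, x1, x2, x3, x4. *)
Require Import Defs.
From mathcomp Require Import all_boot.
From mathcomp Require Import boolp zify.
From Stdlib Require Import Relation_Operators Operators_Properties.

Set Implicit Arguments.
Unset Strict Implicit.
Unset Printing Implicit Defensive.

Section Distance.
Variables (T : finType) (e : rel T).

Lemma has_walkP x y n :
  reflect (exists p, [/\ path e x p, last x p = y & size p = n])
          (has_walk e x y n).
Proof.
apply: (iffP existsP) => [[p /andP[pth /eqP lst]]|[p [pth lst sz]]].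
  by exists p; rewrite size_tuple.
have szP : size p == n by rewrite sz.
by exists (Tuple szP); rewrite pth lst eqxx.
Qed.

Lemma dist_leq x y n : has_walk e x y n -> dist e x y <= n.
Proof.
move=> w; rewrite /dist leqNgt; apply/negP => lt_n.
have lt_nT : n < #|T|.
  by apply: leq_trans lt_n _; rewrite -[X in _ <= X](size_iota 0) find_size.
by have := before_find 0 lt_n; rewrite nth_iota // add0n w.
Qed.

(** A walk shortened to distinct vertices has fewer than [#|T|] edges, so the default value of
    [dist] never occurs between connected vertices. *)
Lemma dist_lt_card x y : connect e x y -> dist e x y < #|T|.
Proof.
case/connectP => p pth ->.
case/shortenP: pth => q pth uq _.
apply: leq_ltn_trans (_ : size q < _).
  by apply: dist_leq; apply/has_walkP; exists q.
by have := uniq_leq_size uq (fun z _ => mem_enum T z); rewrite -cardE.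
Qed.

Lemma has_walk_dist x y : connect e x y -> has_walk e x y (dist e x y).
Proof.
move/dist_lt_card; rewrite /dist => lt_T.
have : has (has_walk e x y) (iota 0 #|T|) by rewrite has_find size_iota.
by move/(nth_find 0); rewrite nth_iota.
Qed.

Lemma distxx x : dist e x x = 0.
Proof.
by apply/eqP; rewrite -leqn0; apply: dist_leq; apply/has_walkP; exists [::].
Qed.

Hypothesis e_conn : forall x y, connect e x y.

Lemma dist_edge x y z : e y z -> dist e x z <= (dist e x y).+1.
Proof.
move=> yz; apply: dist_leq; apply/has_walkP.
have /has_walkP[p [pth lst sz]] := has_walk_dist (e_conn x y).
by exists (rcons p z); rewrite rcons_path last_rcons size_rcons pth lst sz.
Qed.

(** The minimum defining [radius] starts from [diameter e]; the strict bound on [n] keeps this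
    default from being what attains the value. *)
Lemma radius_attained n : n < diameter e -> radius e = n ->
  exists x, ecc e x <= n.
Proof.
move=> lt_diam rad; apply/existsP; apply: contraPT rad => /existsPn ecc_gt.
have : n < radius e.
  rewrite /radius; elim/big_ind: _ => // [p q np nq|x _]; first by rewrite leq_min np.
  by rewrite ltnNge ecc_gt.
by move=> lt_n eq_n; rewrite eq_n ltnn in lt_n.
Qed.

Lemma diameter_attained n : diameter e = n.+1 -> exists x y, dist e x y = n.+1.
Proof.
move=> diam.
have dist_le x y : dist e x y <= n.+1.
  rewrite -diam; apply: leq_trans (leq_bigmax x).
  exact: (leq_bigmax (F := dist e x)).
apply: contrapT => none.
suff : diameter e <= n by rewrite diam ltnn.
apply/bigmax_leqP => x _; apply/bigmax_leqP => y _.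
rewrite -ltnS ltn_neqAle dist_le andbT; apply/negP => /eqP xy.
by apply: none; exists x, y.
Qed.

End Distance.

Section Reachability.
Variables (T : finType) (e : rel T).
Implicit Types (C : config T) (r u v : T).

Definition reachable C r := exists2 C', cops_turn e C C' & captured C' r.

(** Against a robber who stays at [r], the successive turns concatenate into a single one by
    transitivity. *)
Lemma cops_win_reachable C r : cops_win e C r -> reachable C r.
Proof.
elim=> {C r} [C r cap|C r C' turn cap|C r C' turn _ IH].
- by exists C => //; apply: rt_refl.
- by exists C'.
have [|C2 turn2 cap] := IH r; first by left.
by exists C2 => //; apply: rt_trans turn turn2.
Qed.

Lemma sum_uniq_le_size C (s : seq T) :
  uniq s -> \sum_(x <- s) C x <= config_size C.
Proof.
by move=> us; rewrite big_uniq // /config_size [leqRHS](bigID (mem s)) leq_addr.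
Qed.

Hypothesis e_irr : irreflexive e.

Lemma edge_neq u v : e u v -> (u == v) = false.
Proof. by move=> uv; apply/eqP => eq_uv; rewrite eq_uv e_irr in uv. Qed.

Lemma pebbling_move_size C u v : e u v -> 2 <= C u ->
  config_size C = (config_size (pebbling_move C u v)).+1.
Proof.
move=> uv C_u; have vu : v != u by rewrite eq_sym edge_neq.
rewrite /config_size (bigD1 u) // (bigD1 v) //=.
rewrite [in RHS](bigD1 u) // [in RHS](bigD1 v) //=.
rewrite !ffunE eqxx (negPf vu) eqxx.
under [in RHS]eq_bigr => x /andP[/negPf xu /negPf xv] do rewrite ffunE xu xv.
lia.
Qed.

(** Induction on the steps, peeling off the first: it costs one cop, so the induction hypothesis is
    applied to at most two cops. *)
Lemma reachable_cases C r : config_size C <= 3 -> reachable C r ->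
  [\/ 0 < C r, exists2 u, 2 <= C u & e u r |
      exists u v, [/\ 2 <= C u, 0 < C v, e u v & e v r]].
Proof.
move=> + [C' /clos_rt_rt1n_iff turn]; elim: turn => {C C'} [C _ cap|]; first exact: Or31.
move=> C C1 C' [u [v [uv C_u ->]]] _ IH C3 cap.
have uvF := edge_neq uv; have vuF : (v == u) = false by rewrite eq_sym.
have := pebbling_move_size uv C_u.
set D := pebbling_move C u v in IH * => szC.
have D_v : D v = C v + 1 by rewrite ffunE vuF eqxx.
have D_le x : x != v -> D x <= C x by rewrite ffunE => /negPf->; case: ifP; lia.
have D_sum x y : x != y -> D x + D y <= 2.
  move=> xy; have := @sum_uniq_le_size D [:: x; y].
  rewrite !big_cons big_nil /= inE xy; lia.
have [|D_r|[w D_w wr]|[w [z [D_w D_z wz _]]]] := IH _ cap; first lia.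
- have [->|rv] := eqVneq r v; first by apply: Or32; exists u.
  by apply: Or31; apply: leq_trans D_r (D_le _ rv).
(* The first step has put a cop on [v], so only [v] can hold two of the two remaining cops; one of
   these was there from the start. *)
- have [wv|/D_sum] := eqVneq w v; last lia.
  by rewrite wv in D_w wr; apply: Or33; exists u, v; split=> //; lia.
- have := D_sum w z; rewrite edge_neq //; lia.
Qed.

End Reachability.

Section Bounds.
Variables (T : finType) (e : rel T).
Hypotheses (e_sym : symmetric e) (e_irr : irreflexive e).
Hypothesis e_conn : forall x y, connect e x y.

Lemma winning_size4 x : ecc e x <= 2 -> winning_size e 4.
Proof.
move=> ecc2; pose C : config T := [ffun y => if y == x then 4 else 0].
exists C; split.
  rewrite /config_size (bigD1 x) //= ffunE eqxx big1 // => y /negPf yx.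
  by rewrite ffunE yx.
move=> r; have /has_walkP[p [pth lst sz]] := has_walk_dist (e_conn x r).
have sz2 : size p <= 2.
  by rewrite sz; apply: leq_trans ecc2; exact: (leq_bigmax (F := dist e x)).
have step (D : config T) u v : e u v -> 2 <= D u -> cops_turn e D (pebbling_move D u v).
  by move=> uv D_u; apply: rt_step; exists u, v.
case: p pth lst sz2 {sz} => [|y [|z [|//]]] /=.
- by move=> _ <- _; apply: win_captured; rewrite /captured ffunE eqxx.
- rewrite andbT => xy <- _; have yx := edge_neq e_irr xy; rewrite eq_sym in yx.
  apply: (win_turn (C' := pebbling_move C x y)); last by rewrite /captured !ffunE yx eqxx.
  by apply: step => //; rewrite ffunE eqxx.
case/and3P=> xy yz _ <- _.
have yx := edge_neq e_irr xy; rewrite eq_sym in yx.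
have zy := edge_neq e_irr yz; rewrite eq_sym in zy.
(* The four cops on [x] pay for two steps to [y], and the two cops arriving there pay for the step
   to [z]. *)
pose C1 := pebbling_move C x y; pose C2 := pebbling_move C1 x y.
apply: (win_turn (C' := pebbling_move C2 y z)); last first.
  by rewrite /captured ffunE zy eqxx addn1.
apply: rt_trans (step C2 y z yz _); last by rewrite !ffunE yx !eqxx.
apply: rt_trans (step C1 x y xy _); last by rewrite !ffunE !eqxx.
by apply: step => //; rewrite ffunE eqxx.
Qed.

(** The distance from [a] grows by at most one per edge, so reaching 4 after four edges forces the
    value [i] at the [i]-th vertex. *)
Lemma geodesic4 a b : dist e a b = 4 ->
  exists x : nat -> T, forall i, i <= 4 -> dist e a (x i) = i.
Proof.
move=> ab; have /has_walkP[p [+ + sz]] := has_walk_dist (e_conn a b).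
rewrite ab in sz; case: p sz => [|x1 [|x2 [|x3 [|x4 [|//]]]]] //= _.
case/and5P=> /(dist_edge e_conn a) d1 /(dist_edge e_conn a) d2.
move=> /(dist_edge e_conn a) d3 /(dist_edge e_conn a) d4 _ x4b.
(* The default [b] of [nth] supplies the vertex of index 4. *)
rewrite x4b ab distxx in d1 d4; exists (nth b [:: a; x1; x2; x3]).
by case=> [|[|[|[|[|//]]]]] _ /=; rewrite ?distxx //; lia.
Qed.

(** Adjacency is used only through the distance from [a], which changes by at most one along an
    edge. *)
Lemma unreachable_of_size3 (C : config T) a b : dist e a b = 4 ->
  config_size C <= 3 -> ~ forall r, reachable e C r.
Proof.
move=> /geodesic4[x x_dist] C3 all_reach.
have lip u v : e u v ->
    dist e a v <= (dist e a u).+1 /\ dist e a u <= (dist e a v).+1.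
  by move=> uv; split; apply: dist_edge => //; rewrite e_sym.
have neq i j : i <= 4 -> j <= 4 -> i < j -> x i != x j.
  by move=> i4 j4 ij; apply/eqP => /(congr1 (dist e a)); rewrite !x_dist //; lia.
have sum3 u v w : u != v -> u != w -> v != w -> C u + C v + C w <= 3.
  move=> uv uw vw; apply: leq_trans C3.
  have := @sum_uniq_le_size _ C [:: u; v; w].
  by rewrite !big_cons big_nil /= !inE negb_or uv uw vw addn0 addnA; apply.
have cases i := reachable_cases e_irr C3 (all_reach (x i)).
(* If two cops on [u] and one on a neighbour [v] exhaust the supply, each [x i] is [u], [v] or
   adjacent to one of them. Then [x 0] needs one of the two at distance at most 1 from [a], and
   [x 4] one at distance at least 3, which is too far apart for neighbours. *)
have [[u [v [C_u C_v uv]]]|no_pair] :=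
  pselect (exists u v, [/\ 2 <= C u, 0 < C v & e u v]).
  have near i : i <= 4 -> exists2 w, (w == u) || (w == v) & (w = x i) \/ e w (x i).
    have only w : 0 < C w -> (w == u) || (w == v).
      move=> C_w; apply: contraTT C_w; rewrite negb_or => /andP[wu wv].
      have := @sum3 u v w; rewrite (edge_neq e_irr uv) eq_sym wu eq_sym wv; lia.
    move=> i4; have [C_i|[w C_w wi]|[_ [w [_ C_w _ wi]]]] := cases i.
    - by exists (x i); [exact: only | left].
    - by exists w; [apply: only; lia | right].
    - by exists w; [exact: only | right].
  have close i : i <= 4 -> exists2 w, (w == u) || (w == v) &
      i <= (dist e a w).+1 /\ dist e a w <= i.+1.
    move=> i4; have [w w_uv [w_i|/lip w_i]] := near i i4; exists w => //.
      by rewrite w_i x_dist.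
    by rewrite x_dist in w_i.
  have [//|w0 w0P d0] := close 0; have [//|w4 w4P d4] := close 4.
  have [luv lvu] := lip _ _ uv.
  by case/orP: w0P d0 => /eqP->; case/orP: w4P d4 => /eqP->; lia.
have occ i : 0 < C (x i) \/ exists2 u, 2 <= C u & e u (x i).
  have [?|?|[u [v [C_u C_v uv _]]]] := cases i; [by left|by right|].
  by case: no_pair; exists u, v.
have [[u C_u]|no_two] := pselect (exists u, 2 <= C u).
  (* An [x i] too far from [u] needs a cop of its own, since a second vertex with two cops would
     make four. Two such indices also make four cops. *)
  have far i : i <= 4 -> i + 1 < dist e a u \/ dist e a u + 1 < i ->
      0 < C (x i) /\ u != x i.
    move=> i4 i_far; have u_i : u != x i.
      by apply/eqP => /(congr1 (dist e a)); rewrite x_dist //; lia.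
    split=> //; have [//|[w C_w wi]] := occ i.
    have [wu|wu] := eqVneq w u.
      by have := lip _ _ wi; rewrite wu x_dist //; lia.
    have := @sum_uniq_le_size _ C [:: w; u].
    rewrite !big_cons big_nil /= inE wu; lia.
  have two_far i j : i <= 4 -> j <= 4 -> i < j ->
      i + 1 < dist e a u \/ dist e a u + 1 < i ->
      j + 1 < dist e a u \/ dist e a u + 1 < j -> False.
    move=> i4 j4 ij /(far _ i4)[C_i u_i] /(far _ j4)[C_j u_j].
    by have := sum3 _ _ _ u_i u_j (neq _ _ i4 j4 ij); lia.
  (* Wherever [u] lies, two of the five indices differ from its distance to [a] by at least 2. *)
  have [|[|]] : dist e a u <= 1 \/ dist e a u = 2 \/ 3 <= dist e a u by lia.
  - by move=> ?; apply: (@two_far 3 4) => //; lia.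
  - by move=> ?; apply: (@two_far 0 4) => //; lia.
  - by move=> ?; apply: (@two_far 0 1) => //; lia.
(* With no vertex holding two cops, no step is possible, and four distinct [x i] would each need a
   cop. *)
have C_pos i : 0 < C (x i).
  by have [//|[u C_u _]] := occ i; case: no_two; exists u.
have := @sum_uniq_le_size _ C [:: x 0; x 1; x 2; x 3].
rewrite !big_cons big_nil /= !inE !negb_or !neq //.
have := (C_pos 0, C_pos 1, C_pos 2, C_pos 3).
move=> [[[]]]; lia.
Qed.

End Bounds.

Theorem theorem12 (T : finType) (e : rel T) :
  is_tree e -> radius e = 2 -> diameter e = 4 -> cop_pebbling_number e = 4.
Proof.
move=> [[e_sym e_irr] _ e_conn _] rad diam.
rewrite /cop_pebbling_number; case: ex_minnP => m /asboolP[C [szC winC]] min_m.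
apply/eqP; rewrite eqn_leq; apply/andP; split.
  have [|x ecc2] := radius_attained _ rad; first by rewrite diam.
  by apply: min_m; apply/asboolP; apply: winning_size4 ecc2.
have [a [b ab]] := diameter_attained diam.
rewrite leqNgt -szC; apply/negP => C3.
apply: (unreachable_of_size3 e_sym e_irr e_conn ab C3) => r.
exact: cops_win_reachable (winC r).
Qed.
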